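(* Let $g:\mathbb R^N\to\mathbb R$, $g(x)=\max_{i=1,\ldots,\ell}(p_i^Tx+\gamma_i)$, with $(p_i,\gamma_i)\in\mathbb R^N\times\mathbb R$, and let $A\in\mathbb R^{m\times N}$, $y\in\mathbb R^m$, $C\in\mathbb R^{p\times N}$, $d\in\mathbb R^p$. Consider the problem $$(\mathrm{BP}):\quad \min_{x\in\mathbb R^N} g(x)\quad\text{subject to}\quad Ax=y,\ \ Cx\ge d,$$ which is assumed to have an optimal solution. Let $x^*\in\mathbb R^N$ be a feasible point of (BP), and let $\alpha$, $\mathcal I$, $W$ be the index sets and matrix associated with $x^*$ as defined in the context. Then $x^*$ is the unique minimizer of (BP) if and only if the following two conditions hold: (i) $\{v\in\mathbb R^N \mid Av=0,\ C_{\alpha\bullet}v=0,\ Wv=0\}=\{0\}$; and (ii) there exist $z\in\mathbb R^m$, $z'\in\mathbb R^{|\alpha|}_{++}$, and $z''\in\mathbb R^{|\mathcal I|}_{++}$ such that $A^Tz-C_{\alpha\bullet}^Tz'+W^Tz''=0$. Moreover, condition (ii) is equivalent to the following condition: (iii) there exist $w\in\mathbb R^m$, $w'\in\mathbb R^{|\alpha|}_{++}$, and $w''\in\mathbb R^{|\mathcal I|}$ with $0<w''<\mathbf 1$ and $\mathbf 1^Tw''=1$ such that $A^Tw-C_{\alpha\bullet}^Tw'+W^Tw''=0$.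
   Context: Vector inequalities are componentwise; $\mathbf 1$ is the vector of ones; $\mathbb R^n_{++}$ is the set of vectors with all entries strictly positive. For a matrix $M$ and row index set $\alpha$, $M_{\alpha\bullet}$ is the submatrix of rows indexed by $\alpha$. Given $x^*$ with $Cx^*\ge d$: $\alpha:=\{i\in\{1,\ldots,p\} \mid (Cx^*-d)_i=0\}$, $\mathcal I:=\{j\in\{1,\ldots,\ell\}\mid p_j^Tx^*+\gamma_j=g(x^* )\}$, and $W\in\mathbb R^{|\mathcal I|\times N}$ is the matrix whose rows are $p_i^T$, $i\in\mathcal I$. It is a standing convention that for each $i\in\mathcal I$, $p_i$ is not a convex combination of the other $p_j$, $j\in\mathcal I$.
   Formalization: Since (iii) can never hold when |I| = 1 (w'' < 1 contradicts 1^T w'' = 1) while (ii) may, the equivalence of (ii) and (iii) is stated as printed for |I| ≥ 2, and with 0 < w'' ≤ 1 in place of 0 < w'' < 1 when |I| = 1. *)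

(* Defs.v *)
From HB Require Import structures.
From mathcomp Require Import all_boot all_order all_algebra.
From mathcomp Require Import boolp classical_sets reals.
Set Implicit Arguments.
Unset Strict Implicit.
Unset Printing Implicit Defensive.
Import Order.TTheory GRing.Theory Num.Theory.
Local Open Scope ring_scope.

Definition affine_piece (R : realType) (N l : nat)
    (p : 'I_l.+1 -> 'cV[R]_N) (gam : 'I_l.+1 -> R) (i : 'I_l.+1)
    (x : 'cV[R]_N) : R :=
  ((p i)^T *m x) 0 0 + gam i.

(* The default value of the iterated maximum is one of the l.+1 values, so
   this is their maximum. *)
Definition pwa_max (R : realType) (N l : nat)
    (p : 'I_l.+1 -> 'cV[R]_N) (gam : 'I_l.+1 -> R) (x : 'cV[R]_N) : R :=
  \big[Num.max/affine_piece p gam ord0 x]_(i < l.+1) affine_piece p gam i x.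

Definition feasible (R : realType) (N m q : nat) (A : 'M[R]_(m, N))
    (y : 'cV[R]_m) (C : 'M[R]_(q, N)) (d : 'cV[R]_q) (x : 'cV[R]_N) : Prop :=
  A *m x = y /\ (forall i, d i 0 <= (C *m x) i 0).

Definition minimizer (R : realType) (N : nat) (g : 'cV[R]_N -> R)
    (S : 'cV[R]_N -> Prop) (x : 'cV[R]_N) : Prop :=
  S x /\ (forall x', S x' -> g x <= g x').

Definition unique_minimizer (R : realType) (N : nat) (g : 'cV[R]_N -> R)
    (S : 'cV[R]_N -> Prop) (x : 'cV[R]_N) : Prop :=
  minimizer g S x /\ (forall x', minimizer g S x' -> x' = x).

Definition active_constraints (R : realType) (N q : nat) (C : 'M[R]_(q, N))
    (d : 'cV[R]_q) (x : 'cV[R]_N) : {set 'I_q} :=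
  [set i | (C *m x - d) i 0 == 0].

Definition active_pieces (R : realType) (N l : nat)
    (p : 'I_l.+1 -> 'cV[R]_N) (gam : 'I_l.+1 -> R) (x : 'cV[R]_N) :
    {set 'I_l.+1} :=
  [set j | affine_piece p gam j x == pwa_max p gam x].

Definition row_submx (R : realType) (N q : nat) (M : 'M[R]_(q, N))
    (al : {set 'I_q}) : 'M[R]_(#|al|, N) :=
  rowsub (fun k : 'I_#|al| => enum_val k) M.

Definition piece_mx (R : realType) (N l : nat)
    (p : 'I_l.+1 -> 'cV[R]_N) (J : {set 'I_l.+1}) : 'M[R]_(#|J|, N) :=
  \matrix_(k < #|J|) (p (enum_val k))^T.

Definition no_convex_redundancy (R : realType) (N l : nat)
    (p : 'I_l.+1 -> 'cV[R]_N) (J : {set 'I_l.+1}) : Prop :=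
  forall i, i \in J ->
    ~ exists t : 'I_l.+1 -> R,
        [/\ forall j, 0 <= t j,
            \sum_(j in J | j != i) t j = 1
          & p i = \sum_(j in J | j != i) t j *: p j].

Definition pos_vec (R : realType) (n : nat) (v : 'cV[R]_n) : Prop :=
  forall i, 0 < v i 0.

Definition cond_i (R : realType) (N m a b : nat) (A : 'M[R]_(m, N))
    (Ca : 'M[R]_(a, N)) (W : 'M[R]_(b, N)) : Prop :=
  [set v : 'cV[R]_N | [/\ A *m v = 0, Ca *m v = 0 & W *m v = 0]]%classic
  = [set 0]%classic.

Definition cond_ii (R : realType) (N m a b : nat) (A : 'M[R]_(m, N))
    (Ca : 'M[R]_(a, N)) (W : 'M[R]_(b, N)) : Prop :=
  exists (z : 'cV[R]_m) (z' : 'cV[R]_a) (z'' : 'cV[R]_b),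
    [/\ pos_vec z', pos_vec z''
      & A^T *m z - Ca^T *m z' + W^T *m z'' = 0].

Definition cond_iii (R : realType) (N m a b : nat) (A : 'M[R]_(m, N))
    (Ca : 'M[R]_(a, N)) (W : 'M[R]_(b, N)) : Prop :=
  exists (w : 'cV[R]_m) (w' : 'cV[R]_a) (w'' : 'cV[R]_b),
    [/\ pos_vec w', forall k, 0 < w'' k 0 < 1, \sum_k w'' k 0 = 1
      & A^T *m w - Ca^T *m w' + W^T *m w'' = 0].

(* With a single row in W, the requirements w'' < 1 and \sum_k w'' k 0 = 1 of
   cond_iii contradict each other; this variant, with w'' <= 1, is the one that
   makes sense there. *)
Definition cond_iii_le (R : realType) (N m a b : nat) (A : 'M[R]_(m, N))
    (Ca : 'M[R]_(a, N)) (W : 'M[R]_(b, N)) : Prop :=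
  exists (w : 'cV[R]_m) (w' : 'cV[R]_a) (w'' : 'cV[R]_b),
    [/\ pos_vec w', forall k, 0 < w'' k 0 <= 1, \sum_k w'' k 0 = 1
      & A^T *m w - Ca^T *m w' + W^T *m w'' = 0].

(* Main.v *)
(** [xs] is the unique minimizer iff the cone of directions [v] with [A v = 0],
    [Ca v >= 0] and [W v <= 0] is trivial: near [xs] only the active constraints
    and pieces matter, and by convexity of the objective a competitor [x'] yields the
    direction [x' - xs].  Triviality of the cone splits into triviality of its
    lineality space (i) and the absence of a direction with [(Ca v, - W v)]
    nonzero; by Stiemke's theorem of the alternative the latter is (ii).
    Condition (iii) is (ii) normalized by the sum of the entries of [z'']. *)
Require Import Defs.
From HB Require Import structures.
From mathcomp Require Import all_boot all_order all_algebra.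
From mathcomp Require Import boolp classical_sets reals.
Set Implicit Arguments.
Unset Strict Implicit.
Unset Printing Implicit Defensive.
Import Order.TTheory GRing.Theory Num.Theory.
Local Open Scope ring_scope.

(** * Theorems of the alternative *)

Lemma mulmx_entry_ge0 (R : realFieldType) (k : nat) (u : 'rV[R]_k)
    (x : 'cV[R]_k) :
  (forall i, 0 <= u 0 i) -> (forall i, 0 <= x i 0) -> 0 <= (u *m x) 0 0.
Proof.
by move=> u0 x0; rewrite mxE; apply: sumr_ge0 => i _; exact: mulr_ge0.
Qed.

(** A linear form nonnegative on a subspace vanishes there, since [v] and [- v] both lie in it. So
    [c] kills the columns of [cokermx A], which span the kernel of [A]. *)
Lemma submx_of_kernel_ge0 (R : realFieldType) (N m : nat) (A : 'M[R]_(m, N))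
    (c : 'rV[R]_N) :
  (forall v : 'cV_N, A *m v = 0 -> 0 <= (c *m v) 0 0) -> (c <= A)%MS.
Proof.
move=> h; rewrite submxE; apply/eqP/matrixP => i j; rewrite [i]ord1 [RHS]mxE.
pose v := col j (cokermx A).
have Av0 : A *m v = 0 by rewrite /v colE mulmxA mulmx_coker mul0mx.
have <- : (c *m v) 0 0 = (c *m cokermx A) 0 j by rewrite /v colE mulmxA -colE mxE.
apply/eqP; rewrite eq_le h // andbT -oppr_ge0.
by have := h (- v); rewrite !mulmxN Av0 oppr0 mxE; exact.
Qed.

(* Bartl's induction on the number of inequalities: if the first inequality [b]
   is needed, some [y] satisfies all the others but has [c y < 0], hence
   [b y < 0]; projecting along [y] onto the kernel of [b] removes [b]. *)
Lemma farkas (R : realFieldType) (N m k : nat) (A : 'M[R]_(m, N))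
    (B : 'M[R]_(k, N)) (c : 'rV[R]_N) :
  (forall v : 'cV_N, A *m v = 0 -> (forall i, 0 <= (B *m v) i 0) ->
     0 <= (c *m v) 0 0) ->
  exists (z : 'rV[R]_m) (u : 'rV[R]_k),
    (forall i, 0 <= u 0 i) /\ c = z *m A + u *m B.
Proof.
elim: k B c => [|k IH] B c.
  move=> h; have /submxP[z ->] : (c <= A)%MS.
    by apply: submx_of_kernel_ge0 => v Av; apply: h => // -[].
  by exists z, 0; split=> [[]//|]; rewrite mul0mx addr0.
rewrite -(@vsubmxK R 1 k N B).
move: (@usubmx R 1 k N B) (@dsubmx R 1 k N B) => b {}B h.
have colP (v : 'cV_N) : (forall i, 0 <= (B *m v) i 0) -> 0 <= (b *m v) 0 0 ->
    forall i, 0 <= (col_mx b B *m v) i 0.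
  move=> Bv bv i; rewrite mul_col_mx.
  by case: (@split_ordP 1 k i) => j ->; rewrite ?col_mxEu ?col_mxEd // [j]ord1.
have rowE (s : R) (u : 'rV_k) :
    (row_mx s%:M u : 'rV_(1 + k)) *m col_mx b B = s *: b + u *m B.
  by rewrite mul_row_col mul_scalar_mx.
have rowP (s : R) (u : 'rV_k) : 0 <= s -> (forall i, 0 <= u 0 i) ->
    forall i, 0 <= (row_mx s%:M u : 'rV_(1 + k)) 0 i.
  move=> s0 u0 i.
  by case: (@split_ordP 1 k i) => j ->; rewrite ?row_mxEl ?row_mxEr // [j]ord1 mxE.
have [hB|] := pselect (forall v : 'cV_N, A *m v = 0 ->
    (forall i, 0 <= (B *m v) i 0) -> 0 <= (c *m v) 0 0).
  have [z [u [u0 cE]]] := IH _ _ hB.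
  exists z, (row_mx 0%:M u); split; first exact: rowP.
  by rewrite rowE scale0r add0r.
move=> /existsNP[y] /not_implyP[Ay] /not_implyP[By] /negP; rewrite -ltNge => cy.
pose s := (b *m y) 0 0.
have s0 : s < 0.
  by rewrite ltNge; apply/negP => s0; move: cy; rewrite ltNge h //; exact: colP.
(* [P r M] is [M] precomposed with the projection sending [v] to [v - (b v / s) y]. *)
pose P (r : nat) (M : 'M[R]_(r, N)) := M - s^-1 *: (M *m y *m b).
have PE r (M : 'M[R]_(r, N)) v :
    P r M *m v = M *m (v - ((b *m v) 0 0 / s) *: y).
  rewrite mulmxBl mulmxBr -scalemxAl -scalemxAr -(mulmxA (M *m y)).
  by rewrite [b *m v]mx11_scalar mul_mx_scalar scalerA mulrC !mxE !mulr1n.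
have [v Av PBv|z [u [u0 cE]]] := IH (P k B) (P 1%N c).
  rewrite PE; apply: h.
    by rewrite mulmxBr -scalemxAr Av Ay scaler0 subr0.
  apply: colP => [i|]; first by rewrite -PE.
  by rewrite mulmxBr -scalemxAr mxE [X in _ + X]mxE [X in _ - X]mxE -/s divfK ?subrr // lt_eqF.
(* Expanding both projections leaves a multiple of [b]; its coefficient is nonnegative because
   [s < 0], [c y < 0] and [u (B y) >= 0]. *)
exists z, (row_mx (s^-1 * ((c *m y) 0 0 - (u *m (B *m y)) 0 0))%:M u); split.
  apply: rowP => //; apply: mulr_le0; first by rewrite invr_le0 ltW.
  by rewrite subr_le0 (le_trans (ltW cy)) // mulmx_entry_ge0.
have rank1E (w : 'rV_N) : w *m y *m b = (w *m y) 0 0 *: b.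
  by rewrite {1}[w *m y]mx11_scalar mul_scalar_mx.
move/eqP: cE; rewrite subr_eq => /eqP cE; rewrite rowE [LHS]cE.
rewrite mulmxBr -scalemxAr !mulmxA !rank1E !scalerA mulrBr scalerBl.
by rewrite -!addrA; congr (_ + _); rewrite addrC -addrA addrCA.
Qed.

(** Each form [- row i B] vanishes on the cone [A v = 0], [B v >= 0], so Farkas' lemma writes it as
    [z_i A + u_i B] with [u_i >= 0]. Summing over [i] and moving the rows across gives every row of
    [B] weight at least 1. *)
Lemma stiemke (R : realFieldType) (N m k : nat) (A : 'M[R]_(m, N))
    (B : 'M[R]_(k, N)) :
  (forall v : 'cV_N, A *m v = 0 -> (forall i, 0 <= (B *m v) i 0) ->
     B *m v = 0) ->
  exists (z : 'rV[R]_m) (u : 'rV[R]_k),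
    (forall i, 0 < u 0 i) /\ z *m A + u *m B = 0.
Proof.
move=> h.
have ex i : exists zu : 'rV[R]_m * 'rV[R]_k, (forall j, 0 <= zu.2 0 j) /\
    - row i B = zu.1 *m A + zu.2 *m B.
  have [v Av Bv|z [u [? ?]]] := @farkas R N m k A B (- row i B).
    by rewrite mulNmx -row_mul h // row0 oppr0 mxE.
  by exists (z, u).
have [f fP] := choice ex.
exists (\sum_i (f i).1), (const_mx 1 + \sum_i (f i).2); split=> [j|].
  rewrite !mxE ltr_pwDl // summxE; apply: sumr_ge0 => i _.
  by case: (fP i).
rewrite mulmxDl addrCA !mulmx_suml -big_split /=.
under eq_bigr => i _ do rewrite -(proj2 (fP i)).
rewrite mulmx_sum_row -big_split /= big1 // => i _.
by rewrite mxE scale1r subrr.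
Qed.

(** * Step lengths and active pieces *)

Lemma exists_nonneg_step (R : realFieldType) (I : finType) (s r : I -> R) :
  (forall i, 0 <= s i) -> (forall i, s i = 0 -> 0 <= r i) ->
  exists2 t, 0 < t & forall i, 0 <= s i + t * r i.
Proof.
(* The reciprocal of [1 + S] serves all indices at once; the 1 covers [S = 0], and terms with
   [s i = 0] are 0 by the convention for division by zero. *)
move=> s0 r0; pose S := \sum_i `|r i| / s i.
have S0 : 0 <= S by apply: sumr_ge0 => i _; rewrite divr_ge0.
have S1 : 0 < 1 + S by rewrite ltr_pwDl.
exists (1 + S)^-1 => [|i]; first by rewrite invr_gt0.
have [si0|si_neq0] := eqVneq (s i) 0.
  by rewrite si0 add0r mulr_ge0 ?invr_ge0 ?(ltW S1) // r0.
have si_gt0 : 0 < s i by rewrite lt_def si_neq0 s0.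
have rS : `|r i| <= (1 + S) * s i.
  rewrite -ler_pdivrMr // /S (bigD1 i) //= addrCA lerDl addr_ge0 //.
  by apply: sumr_ge0 => j _; rewrite divr_ge0.
rewrite -(pmulr_rge0 _ S1) mulrDr mulrA divff ?gt_eqF // mul1r.
by rewrite -lerBlDr sub0r (le_trans _ rS) // ler_normr lexx orbT.
Qed.

Section PiecewiseAffineMaximum.
Variables (R : realType) (N l : nat).
Variables (p : 'I_l.+1 -> 'cV[R]_N) (gam : 'I_l.+1 -> R).

Lemma affine_pieceD x v i :
  affine_piece p gam i (x + v) = affine_piece p gam i x + ((p i)^T *m v) 0 0.
Proof. by rewrite /affine_piece mulmxDr mxE addrAC. Qed.

Lemma affine_piece_le_pwa_max i x : affine_piece p gam i x <= pwa_max p gam x.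
Proof. exact: le_bigmax. Qed.

Lemma pwa_max_le x c :
  (forall i, affine_piece p gam i x <= c) -> pwa_max p gam x <= c.
Proof. by move=> h; apply: bigmax_le. Qed.

(** Otherwise every piece, including the default [ord0], would lie strictly below their maximum. *)
Lemma active_pieces_neq0 x : (0 < #|active_pieces p gam x|)%N.
Proof.
rewrite card_gt0; apply/negP => /eqP J0.
suff : pwa_max p gam x < pwa_max p gam x by rewrite ltxx.
have lt i : affine_piece p gam i x < pwa_max p gam x.
  rewrite lt_def affine_piece_le_pwa_max andbT eq_sym.
  by have /setP/(_ i) := J0; rewrite !inE => ->.
by apply: bigmax_lt.
Qed.

End PiecewiseAffineMaximum.

Lemma row_submx_mulE (R : realType) (N q : nat) (M : 'M[R]_(q, N))
    (al : {set 'I_q}) (v : 'cV[R]_N) k :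
  (row_submx M al *m v) k 0 = (M *m v) (enum_val k) 0.
Proof. by rewrite !mxE; apply: eq_bigr => j _; rewrite mxE. Qed.

Lemma piece_mx_mulE (R : realType) (N l : nat) (p : 'I_l.+1 -> 'cV[R]_N)
    (J : {set 'I_l.+1}) (v : 'cV[R]_N) k :
  (piece_mx p J *m v) k 0 = ((p (enum_val k))^T *m v) 0 0.
Proof. by rewrite !mxE; apply: eq_bigr => j _; rewrite !mxE. Qed.

(** * Algebraic forms of the conditions *)

Lemma trivial_coneP (R : realType) (N m a b : nat) (A : 'M[R]_(m, N))
    (Ca : 'M[R]_(a, N)) (W : 'M[R]_(b, N)) :
  (forall v : 'cV_N, A *m v = 0 -> (forall k, 0 <= (Ca *m v) k 0) ->
     (forall k, (W *m v) k 0 <= 0) -> v = 0)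
  <-> cond_i A Ca W /\ cond_ii A Ca W.
Proof.
split=> [cone0|[hi [z [z' [z'' [z'0 z''0 zE]]]]] v Av Cv Wv].
  split.
    apply/seteqP; split=> v /= => [[Av Cv Wv]|->]; last by rewrite !mulmx0.
    by apply: cone0 => // k; rewrite ?Cv ?Wv mxE.
  have [v Av Bv|z [u [u0 uE]]] := @stiemke R N m _ A (col_mx Ca (- W)).
    rewrite (cone0 v) ?mulmx0 // => k; rewrite mul_col_mx in Bv.
      by have := Bv (lshift _ k); rewrite col_mxEu.
    by have := Bv (rshift _ k); rewrite col_mxEd mulNmx mxE oppr_ge0.
  (* Stiemke's identity carries [Ca] with a plus and [W] with a minus sign, so it is negated. *)
  exists (- z^T), (lsubmx u)^T, (rsubmx u)^T; split=> [k|k|].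
  - by rewrite !mxE.
  - by rewrite !mxE.
  have : (z *m A + u *m col_mx Ca (- W))^T = 0 by rewrite uE trmx0.
  rewrite -{1}(hsubmxK u) mul_row_col mulmxN !raddfD raddfN /= !trmx_mul => E.
  by rewrite mulmxN -[RHS]oppr0 -E !opprD opprK addrA.
have ge0 (n : nat) (u x : 'cV[R]_n) : pos_vec u -> (forall k, 0 <= x k 0) ->
    0 <= (u^T *m x) 0 0 /\ ((u^T *m x) 0 0 = 0 -> x = 0).
  move=> u0 x0; rewrite mxE.
  have t0 k : true -> 0 <= u^T 0 k * x k 0 by rewrite mxE mulr_ge0 // ltW.
  split=> [|/eqP]; first exact: sumr_ge0.
  rewrite psumr_eq0 // => /allP ux0; apply/colP => k.
  have := ux0 k (mem_index_enum _); rewrite !mxE mulf_eq0 gt_eqF ?u0 //=.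
  by move/eqP.
have NWv k : 0 <= (- (W *m v)) k 0 by rewrite mxE oppr_ge0.
have [c0 cP] := ge0 _ _ _ z'0 Cv.
have [w0 wP] := ge0 _ _ _ z''0 NWv.
(* Pairing (ii) with [v] kills the [A] term. The other two have the same sign and sum to zero, so
   both vanish, and strict positivity of the weights puts [v] in the set of (i). *)
have : ((A^T *m z - Ca^T *m z' + W^T *m z'')^T *m v) 0 0 = 0.
  by rewrite zE trmx0 mul0mx mxE.
rewrite !raddfD raddfN /= !trmx_mul !trmxK !mulmxDl mulNmx -!mulmxA Av mulmx0 add0r.
rewrite -[W *m v]opprK mulmxN -opprD mxE [X in - X]mxE => /eqP; rewrite oppr_eq0 paddr_eq0 //.
move=> /andP[/eqP/cP Cv0 /eqP/wP/eqP]; rewrite oppr_eq0 => /eqP Wv0.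
have : [set v : 'cV[R]_N | [/\ A *m v = 0, Ca *m v = 0 & W *m v = 0]]%classic v.
  by [].
by rewrite hi.
Qed.

Lemma cond_iii_leP (R : realType) (N m a b : nat) (A : 'M[R]_(m, N))
    (Ca : 'M[R]_(a, N)) (W : 'M[R]_(b, N)) :
  (0 < b)%N -> cond_ii A Ca W <-> cond_iii_le A Ca W.
Proof.
move=> b0; split=> [[z [z' [z'' [z'0 z''0 zE]]]]|]; last first.
  move=> [w [w' [w'' [w'0 w''0 _ wE]]]]; exists w, w', w''; split=> // k.
  by have /andP[] := w''0 k.
pose s := \sum_k z'' k 0.
have le_s k : z'' k 0 <= s.
  rewrite /s (bigD1 k) //= lerDl; apply: sumr_ge0 => j _; exact: ltW.
(* [0 < b] supplies an entry of [z''], so the normalizing sum is positive. *)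
have s0 : 0 < s := lt_le_trans (z''0 (Ordinal b0)) (le_s _).
exists (s^-1 *: z), (s^-1 *: z'), (s^-1 *: z''); split=> [k|k||].
- by rewrite mxE mulr_gt0 ?invr_gt0.
- by rewrite mxE mulr_gt0 ?invr_gt0 //= mulrC ler_pdivrMr ?mul1r.
- under eq_bigr => k _ do rewrite mxE.
  by rewrite -mulr_sumr mulVf ?gt_eqF.
by rewrite -!scalemxAr -scalerBr -scalerDr zE scaler0.
Qed.

(** A second positive entry keeps each entry of a vector with sum 1 strictly below 1. *)
Lemma cond_iii_leE (R : realType) (N m a b : nat) (A : 'M[R]_(m, N))
    (Ca : 'M[R]_(a, N)) (W : 'M[R]_(b, N)) :
  (1 < b)%N -> cond_iii_le A Ca W <-> cond_iii A Ca W.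
Proof.
move=> b1; split=> -[w [w' [w'' [w'0 w''0 w1 wE]]]]; exists w, w', w'';
  split=> // k; have /andP[wk0 wk1] := w''0 k; rewrite wk0 /=; last exact: ltW.
have [j jk] : exists j : 'I_b, j != k.
  have /card_gt0P[j] : (0 < #|predC1 k|)%N by rewrite cardC1 card_ord -ltnS prednK // ltnW.
  by exists j.
rewrite -w1 (bigD1 k) //= ltrDl (bigD1 j) //= ltr_pwDl //.
  by have /andP[] := w''0 j.
by apply: sumr_ge0 => i _; have /andP[/ltW] := w''0 i.
Qed.

(** * Unique minimizers and the cone of directions *)

Lemma unique_minimizer_coneP (R : realType) (N m q l : nat)
    (p : 'I_l.+1 -> 'cV[R]_N) (gam : 'I_l.+1 -> R)
    (A : 'M[R]_(m, N)) (y : 'cV[R]_m) (C : 'M[R]_(q, N)) (d : 'cV[R]_q)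
    (xs : 'cV[R]_N) :
  feasible A y C d xs ->
  unique_minimizer (pwa_max p gam) (feasible A y C d) xs <->
  (forall v : 'cV_N, A *m v = 0 ->
     (forall k, 0 <= (row_submx C (active_constraints C d xs) *m v) k 0) ->
     (forall k, (piece_mx p (active_pieces p gam xs) *m v) k 0 <= 0) -> v = 0).
Proof.
move=> [Axs Cxs]; split=> [[[_ mins] uniq] v Av Cv Wv|cone0].
  (* [s] collects the slacks of constraints and pieces at [xs], [r] their rates of change along [v];
     the sum type yields one step length for both. *)
  pose s (i : 'I_q + 'I_l.+1) := match i with
    | inl i => (C *m xs) i 0 - d i 0
    | inr j => pwa_max p gam xs - affine_piece p gam j xs end.
  pose r (i : 'I_q + 'I_l.+1) := match i with
    | inl i => (C *m v) i 0
    | inr j => - ((p j)^T *m v) 0 0 end.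
  have [[i|j]|[i|j]|t t0 tP] := @exists_nonneg_step R _ s r.
  - by rewrite subr_ge0.
  - by rewrite subr_ge0 affine_piece_le_pwa_max.
  - move=> si; have iJ : i \in active_constraints C d xs.
      by rewrite inE mxE [X in _ + X]mxE; apply/eqP.
    by have := Cv (enum_rank_in iJ i); rewrite row_submx_mulE enum_rankK_in.
  - move=> /eqP; rewrite subr_eq0 eq_sym => sj.
    have jJ : j \in active_pieces p gam xs by rewrite inE.
    have := Wv (enum_rank_in jJ j).
    by rewrite piece_mx_mulE enum_rankK_in //= oppr_ge0.
  have feas : feasible A y C d (xs + t *: v).
    split=> [|i]; first by rewrite mulmxDr -scalemxAr Av scaler0 addr0.
    rewrite mulmxDr -scalemxAr mxE [X in _ + X]mxE.
    by have := tP (inl i); rewrite /= addrAC subr_ge0.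
  have gle : pwa_max p gam (xs + t *: v) <= pwa_max p gam xs.
    apply: pwa_max_le => j; rewrite affine_pieceD -scalemxAr [X in _ + X]mxE.
    by have := tP (inr j); rewrite /= mulrN -addrA -opprD subr_ge0.
  have /eqP : xs + t *: v = xs.
    by apply: uniq; split=> // x' /mins; exact: le_trans.
  by rewrite -subr_eq0 addrAC subrr add0r scaler_eq0 gt_eqF //= => /eqP.
(* Used twice: a strictly better feasible point would equal [xs], which is absurd, and every
   minimizer equals [xs]. *)
have improving x' : feasible A y C d x' ->
    pwa_max p gam x' <= pwa_max p gam xs -> x' = xs.
  move=> [Ax' Cx'] le; apply/eqP; rewrite -subr_eq0; apply/eqP.
  apply: cone0 => [|k|k].
  - by rewrite mulmxBr Ax' Axs subrr.
  - rewrite row_submx_mulE mulmxBr mxE [X in _ + X]mxE.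
    have := enum_valP k; rewrite inE mxE [X in _ + X]mxE subr_eq0 => /eqP ->.
    by rewrite subr_ge0.
  - rewrite piece_mx_mulE.
    have := enum_valP k; rewrite inE => /eqP gE.
    (* An active piece at [x'] is at most the objective at [x'], hence at most the objective at
       [xs], which is its own value there. *)
    rewrite -(lerD2l (affine_piece p gam (enum_val k) xs)) -affine_pieceD.
    rewrite addr0 addrC subrK gE (le_trans _ le) //.
    exact: affine_piece_le_pwa_max.
split=> [|x' [fx' minx']]; last by apply: improving => //; exact: minx'.
split=> // x' fx'; rewrite leNgt; apply/negP => lt.
by move: (lt); rewrite (improving x' fx' (ltW lt)) ltxx.
Qed.

Theorem theorem3p1 (R : realType) (N m q l : nat)
    (p : 'I_l.+1 -> 'cV[R]_N) (gam : 'I_l.+1 -> R)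
    (A : 'M[R]_(m, N)) (y : 'cV[R]_m) (C : 'M[R]_(q, N)) (d : 'cV[R]_q)
    (hopt : exists x, minimizer (pwa_max p gam) (feasible A y C d) x)
    (xs : 'cV[R]_N) (hxs : feasible A y C d xs)
    (hconv : no_convex_redundancy p (active_pieces p gam xs)) :
  let J := active_pieces p gam xs in
  let Ca := row_submx C (active_constraints C d xs) in
  let W := piece_mx p J in
  [/\ unique_minimizer (pwa_max p gam) (feasible A y C d) xs
        <-> cond_i A Ca W /\ cond_ii A Ca W,
      (1 < #|J|)%N -> (cond_ii A Ca W <-> cond_iii A Ca W)
    & #|J| = 1%N -> (cond_ii A Ca W <-> cond_iii_le A Ca W)].
Proof.
move=> J Ca W; split=> [|J1|J1].
- by rewrite -trivial_coneP; exact: unique_minimizer_coneP.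
- by rewrite -cond_iii_leE //; apply: cond_iii_leP; exact: active_pieces_neq0.
- by apply: cond_iii_leP; exact: active_pieces_neq0.
Qed.
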